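(* Let $A$ be a $K$-algebra and let $W$ be a two-dimensional absolutely reducible $A$-module, with a fixed basis $\{w_1,w_2\}$. Then there are $x,y\in K$ and $\alpha_1,\alpha_2\in\mathrm{Alg}_K(A,K)$ such that $xy\neq 1$ and, for any $a\in A$, $$a w_1=\frac{1}{1-xy}\left[\alpha_1(a)-xy\,\alpha_2(a)\right]w_1+\frac{y}{1-xy}\left[\alpha_1(a)-\alpha_2(a)\right]w_2,$$ $$a w_2=\frac{-x}{1-xy}\left[\alpha_1(a)-\alpha_2(a)\right]w_1+\frac{1}{1-xy}\left[-xy\,\alpha_1(a)+\alpha_2(a)\right]w_2.$$
   Context: $K$ is a field; algebras are associative and unital. $\mathrm{Alg}_K(A,K)$ is the set of $K$-algebra morphisms $A\to K$. A two-dimensional $A$-module $W$ is absolutely reducible if it is a direct sum of two submodules of dimension one. *)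

(* Defs.v *)
From HB Require Import structures.
From mathcomp Require Import all_boot all_algebra.

Set Implicit Arguments.
Unset Strict Implicit.
Unset Printing Implicit Defensive.

Import GRing.Theory.
Local Open Scope ring_scope.

(* MathComp has no A-modules over a K-algebra A together with their K-linear  *)
(* dimension theory.  Here a finite-dimensional left A-module is a vectType   *)
(* over K carrying a unital ring action of A; [amodZ] says that the vector    *)
(* space structure is the one obtained from A by restriction of scalars.      *)
Record amodule (K : fieldType) (A : algType K) (W : vectType K) := AModule {
  amod_act :> A -> W -> W;
  amodM  : forall a b w, amod_act (a * b) w = amod_act a (amod_act b w);
  amod1  : forall w, amod_act 1 w = w;
  amodDl : forall a b w, amod_act (a + b) w = amod_act a w + amod_act b w;
  amodDr : forall a v w, amod_act a (v + w) = amod_act a v + amod_act a w;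
  amodZ  : forall (k : K) w, amod_act k%:A w = k *: w
}.

Definition submodule (K : fieldType) (A : algType K) (W : vectType K)
    (act : amodule A W) (U : {vspace W}) : Prop :=
  forall (a : A) (u : W), u \in U -> act a u \in U.

Definition absolutely_reducible (K : fieldType) (A : algType K)
    (W : vectType K) (act : amodule A W) : Prop :=
  exists U1 U2 : {vspace W},
    [/\ submodule act U1 /\ submodule act U2,
        \dim U1 = 1%N /\ \dim U2 = 1%N,
        directv (U1 + U2)
      & (U1 + U2)%VS = fullv].

(* Main.v *)
(* Each one-dimensional summand is spanned by a common eigenvector of A, on
   which A acts through a character.  Expand the two eigenvectors in the basis
   w1, w2: the coordinate matrix is invertible, so, up to swapping the
   eigenvectors, its diagonal entries are nonzero.  Rescaling then turns the
   eigenvectors into w1 + y w2 and x w1 + w2 with 1 - x y != 0, and the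
   formulas follow by inverting this change of basis. *)
Require Import Defs.
From HB Require Import structures.
From mathcomp Require Import all_boot all_algebra.
From mathcomp Require Import ring.

Set Implicit Arguments.
Unset Strict Implicit.
Unset Printing Implicit Defensive.

Import GRing.Theory.
Local Open Scope ring_scope.

(** The scalars [k%:A] are central in [A], so they can be moved past [a]. *)
Lemma amodZr (K : fieldType) (A : algType K) (W : vectType K)
    (act : amodule A W) a (k : K) w : act a (k *: w) = k *: act a w.
Proof. by rewrite -!(amodZ act) -!amodM mulr_algl mulr_algr. Qed.

Lemma dim1_vline (K : fieldType) (W : vectType K) (U : {vspace W}) :
  \dim U = 1%N -> exists2 u, u != 0 & U = <[u]>%VS.
Proof.
move=> dimU; have u0 : vpick U != 0 by rewrite vpick0 -dimv_eq0 dimU.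
exists (vpick U) => //; apply/esym/eqP.
by rewrite eqEdim -memvE memv_pick dim_vline u0 dimU.
Qed.

(** The character is the eigenvalue of [a] on [u]. Each algebra morphism law is an identity between
    multiples of [u], and [u != 0] lets [u] be cancelled; commutativity of [K] absorbs the order
    reversal in products. *)
Lemma line_character (K : fieldType) (A : algType K) (W : vectType K)
    (act : amodule A W) (u : W) :
    u != 0 -> submodule act <[u]> ->
  exists alpha : {lrmorphism A -> K | *%R}, forall a, act a u = alpha a *: u.
Proof.
move=> u0 subU.
pose f a : K := coord [tuple u] 0 (act a u).
have fE a : act a u = f a *: u.
  (* [coord] is total; it recovers the vector only because stability keeps [act a u] on the line. *)
  have : act a u \in <<[tuple u]>>%VS by rewrite span_seq1 subU ?memv_line.
  by move/coord_span; rewrite big_ord1.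
have inj_u (k l : K) : k *: u = l *: u -> k = l.
  move/eqP; rewrite -subr_eq0 -scalerBl scaler_eq0 (negPf u0) orbF subr_eq0.
  by move/eqP.
have f1 : f 1 = 1 by apply: inj_u; rewrite -fE amod1 scale1r.
have fM a b : f (a * b) = f a * f b.
  by apply: inj_u; rewrite -fE amodM fE amodZr fE scalerA mulrC.
have fD a b : f (a + b) = f a + f b.
  by apply: inj_u; rewrite scalerDl -!fE amodDl.
have fZ k a : f (k *: a) = k * f a.
  by apply: inj_u; rewrite -fE -mulr_algl amodM amodZ fE scalerA.
have f_additive : zmod_morphism f.
  by move=> a b; rewrite fD -scaleN1r fZ mulN1r.
pose fadd := GRing.isZmodMorphism.Build A K f f_additive.
pose fmul := GRing.isMonoidMorphism.Build A K f (f1, fM).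
pose fscal := GRing.isScalable.Build K A K *%R f fZ.
pose alpha : {lrmorphism A -> K | *%R} := HB.pack f fadd fmul fscal.
by exists alpha.
Qed.

Lemma scaler_comb2 (R : pzRingType) (V : lmodType R) (c e p q r s : R) (v w : V) :
  c *: (p *: v + q *: w) + e *: (r *: v + s *: w)
    = (c * p + e * r) *: v + (c * q + e * s) *: w.
Proof. by rewrite !scalerDr !scalerA addrACA -!scalerDl. Qed.

(** Here [u1 / p = w1 + y w2] and [u2 / s = x w1 + w2], and [1 - x * y] is the determinant divided
    by [p * s]. The two eigenvectors enter as parameters so that their roles can be exchanged. *)
Lemma eigenbasis_action (K : fieldType) (A : algType K) (W : vectType K)
    (act : amodule A W) (w1 w2 u1 u2 : W) (p q r s : K) (f1 f2 : A -> K) :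
    u1 = p *: w1 + q *: w2 -> u2 = r *: w1 + s *: w2 ->
    (forall a, act a u1 = f1 a *: u1) -> (forall a, act a u2 = f2 a *: u2) ->
    p != 0 -> s != 0 -> p * s - q * r != 0 ->
  let x := r / s in let y := q / p in
  x * y != 1 /\
    forall a : A,
      act a w1 = (1 / (1 - x * y) * (f1 a - x * y * f2 a)) *: w1
               + (y / (1 - x * y) * (f1 a - f2 a)) *: w2 /\
      act a w2 = (- x / (1 - x * y) * (f1 a - f2 a)) *: w1
               + (1 / (1 - x * y) * (- (x * y) * f1 a + f2 a)) *: w2.
Proof.
move=> u1E u2E fu1 fu2 p0 s0 D0 x y.
have xyE : 1 - x * y = (p * s - q * r) / (p * s).
  by rewrite /x /y; field; rewrite p0 s0.
have xy0 : 1 - x * y != 0 by rewrite xyE mulf_neq0 ?invr_neq0 ?mulf_neq0.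
split; first by rewrite eq_sym -subr_eq0.
have act_comb a c e :
    act a (c *: u1 + e *: u2) = (c * f1 a) *: u1 + (e * f2 a) *: u2.
  by rewrite amodDr !amodZr fu1 fu2 !scalerA.
(* Cramer's rule: the coefficients here and in [w2E] are the rows of the inverse coordinate
   matrix. *)
have w1E : w1 = (s / (p * s - q * r)) *: u1 + (- q / (p * s - q * r)) *: u2.
  rewrite u1E u2E scaler_comb2 -[LHS]addr0 -{1}(scale1r w1) -(scale0r w2).
  by congr (_ *: _ + _ *: _); field.
have w2E : w2 = (- r / (p * s - q * r)) *: u1 + (p / (p * s - q * r)) *: u2.
  rewrite u1E u2E scaler_comb2 -[LHS]add0r -{1}(scale1r w2) -(scale0r w1).
  by congr (_ *: _ + _ *: _); field.
move=> a; split.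
  rewrite {1}w1E act_comb u1E u2E scaler_comb2 xyE /x /y.
  by congr (_ *: _ + _ *: _); field; rewrite ?p0 ?s0 ?D0.
rewrite {1}w2E act_comb u1E u2E scaler_comb2 xyE /x /y.
by congr (_ *: _ + _ *: _); field; rewrite ?p0 ?s0 ?D0.
Qed.

Theorem theorem3p16 (K : fieldType) (A : algType K) (W : vectType K)
    (act : amodule A W) (w1 w2 : W) :
  \dim {:W} = 2%N ->
  absolutely_reducible act ->
  basis_of fullv [:: w1; w2] ->
  exists (x y : K) (alpha1 alpha2 : {lrmorphism A -> K | *%R}),
    x * y != 1 /\
    forall a : A,
      act a w1 = (1 / (1 - x * y) * (alpha1 a - x * y * alpha2 a)) *: w1
               + (y / (1 - x * y) * (alpha1 a - alpha2 a)) *: w2 /\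
      act a w2 = (- x / (1 - x * y) * (alpha1 a - alpha2 a)) *: w1
               + (1 / (1 - x * y) * (- (x * y) * alpha1 a + alpha2 a)) *: w2.
Proof.
move=> _ [U1 [U2 [[sub1 sub2] [dim1 dim2] dxU _]]] /andP[/eqP spanW _].
have [u1 u1_0 U1E] := dim1_vline dim1.
have [u2 u2_0 U2E] := dim1_vline dim2.
rewrite {}U1E {}U2E in sub1 sub2 dxU.
have [alpha1 fu1] := line_character u1_0 sub1.
have [alpha2 fu2] := line_character u2_0 sub2.
have coords u : exists p q, u = p *: w1 + q *: w2.
  have : u \in <<[:: w1; w2]>>%VS by rewrite spanW memvf.
  rewrite span_cons span_seq1 => /memv_addP[_ /vlineP[p ->] [_ /vlineP[q ->] ->]].
  by exists p, q.
have [p [q u1E]] := coords u1; have [r [s u2E]] := coords u2.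
(* A relation puts [c *: u1] in both lines, which meet only in zero. *)
have indep c e : c *: u1 + e *: u2 = 0 -> c = 0 /\ e = 0.
  move/directv_addP: dxU => capU /eqP; rewrite addr_eq0 => /eqP cuE.
  have : c *: u1 \in (<[u1]> :&: <[u2]>)%VS.
    by rewrite memv_cap memvZ ?memv_line // cuE rpredN memvZ ?memv_line.
  rewrite capU memv0 => /eqP cu0; move/eqP: (cu0).
  rewrite scaler_eq0 (negPf u1_0) orbF => /eqP c0.
  move/eqP: cuE; rewrite cu0 eq_sym oppr_eq0 scaler_eq0 (negPf u2_0) orbF.
  by split=> //; apply/eqP.
(* The rows of the adjugate give [s u1 - q u2 = D w1] and [- r u1 + p u2 = D w2], where [D] is the
   determinant. If [D = 0], independence forces [q = p = 0], hence [u1 = 0]. *)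
have D0 : p * s - q * r != 0.
  apply/eqP=> D0; move/eqP: u1_0; apply.
  have [_ q0] : s = 0 /\ - q = 0.
    apply: indep; rewrite u1E u2E scaler_comb2.
    have -> : s * p + - q * r = p * s - q * r by ring.
    have -> : s * q + - q * s = 0 by ring.
    by rewrite D0 !scale0r addr0.
  have [_ p0] : - r = 0 /\ p = 0.
    apply: indep; rewrite u1E u2E scaler_comb2.
    have -> : - r * q + p * s = p * s - q * r by ring.
    have -> : - r * p + p * r = 0 by ring.
    by rewrite D0 !scale0r addr0.
  by rewrite u1E p0 -[q]opprK q0 oppr0 !scale0r addr0.
have [/norP[p0 s0]|] := boolP (~~ ((p == 0) || (s == 0))).
  exists (r / s), (q / p), alpha1, alpha2.
  exact: (eigenbasis_action u1E u2E fu1 fu2 p0 s0 D0).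
(* With [p * s = 0] the determinant is [- (q * r)], so [q] and [r] are nonzero. Exchanging the
   eigenvectors puts them on the diagonal and only changes the sign of the determinant. *)
rewrite negbK -mulf_eq0 => /eqP ps0.
have /norP[q0 r0] : ~~ ((q == 0) || (r == 0)).
  by rewrite -mulf_eq0 -oppr_eq0 -sub0r -[X in X - _]ps0.
have D0' : r * q - s * p != 0.
  by rewrite -oppr_eq0 opprB [s * p]mulrC [r * q]mulrC.
exists (p / q), (s / r), alpha2, alpha1.
exact: (eigenbasis_action u2E u1E fu2 fu1 r0 q0 D0').
Qed.
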